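(* For all $n\ge1$, (i) $S_{1,3}(n)=\dfrac{1}{4^n}\zeta^\star(\{4\}^n)$; (ii) $S^\star_{1,3}(n)=\displaystyle\sum_{k=0}^n\frac{1}{4^k}\zeta^\star(\{4\}^k)\,\zeta(\{4\}^{n-k})$.
   Context: $\zeta(k_1,\dots,k_r)=\sum_{0<m_1<\dots<m_r}\prod m_i^{-k_i}$, $\zeta^\star(k_1,\dots,k_r)=\sum_{0<m_1\le\dots\le m_r}\prod m_i^{-k_i}$, with value $1$ for the empty index; $\{4\}^n$ means $4$ repeated $n$ times. Skew diagrams: for partitions $\lambda=(\lambda_1,\dots,\lambda_h)$, $\mu=(\mu_1,\dots,\mu_r)$ with $\mu_j<\lambda_j$ ($\mu_j=0$ for $j>r$), $D(\lambda/\mu)=\{(i,j):1\le i\le h,\mu_i<j\le\lambda_i\}$; corners are cells $(i,j)$ with $(i,j+1),(i+1,j)\notin D$. For a filling $\mathbf k=(k_{i,j})$ by positive integers with entries $\ge2$ at corners, $\zeta(\mathbf k)=\sum\prod m_{i,j}^{-k_{i,j}}$ over fillings $(m_{i,j})$ by positive integers, strictly increasing down columns and weakly increasing along rows. For positive integers $a$, $b\ge2$, the diagram is checkerboardable if there is a (unique) filling $\mathbf k_{a,b}$ with $k_{i,j}$ depending only on the parity of $i-j$, equal to $a$ on one parity class and $b$ on the other, and equal to $b$ at all corners; $\zeta(a,b;\lambda/\mu):=\zeta(\mathbf k_{a,b})$. Notation: $\delta_n=(n,\dots,1)$, $\delta_0=\emptyset$. $S_{1,3}(n)=\zeta(1,3;(n,n,n-1,\dots,2,1)/\delta_{n-1})$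 (outer partition with $n+1$ parts) and $S^\star_{1,3}(n)=\zeta(1,3;(n+1,n,\dots,3,2)/\delta_{n-1})$ (outer partition with $n$ parts). *)

(* Defs.v *)
From HB Require Import structures.
From mathcomp Require Export all_boot all_order all_algebra.
From mathcomp Require Export all_classical all_reals all_analysis.
From mathcomp Require Import zify.

Set Implicit Arguments.
Unset Strict Implicit.
Unset Printing Implicit Defensive.

Import Order.TTheory GRing.Theory Num.Theory.
Local Open Scope classical_set_scope.
Local Open Scope ring_scope.

(* All the series below have nonnegative terms, so they are unconditional sums
   with values in [0, +oo]. *)

Section MultipleZeta.
Variable R : realType.

Definition mzterm (k : seq nat) (m : (size k).-tuple nat) : R :=
  \prod_(i < size k) (tnth m i)%:R ^- nth 0%N k i.

Definition mzeta (k : seq nat) : \bar R :=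
  \esum_(m in [set m : (size k).-tuple nat | all (leq 1) m /\ sorted ltn m])
    (mzterm m)%:E.

Definition mzeta_star (k : seq nat) : \bar R :=
  \esum_(m in [set m : (size k).-tuple nat | all (leq 1) m /\ sorted leq m])
    (mzterm m)%:E.

End MultipleZeta.

Section SkewDiagrams.
Local Open Scope nat_scope.

Definition is_partition (l : seq nat) : bool := sorted geq l && all (leq 1) l.

Definition is_skew (lam mu : seq nat) : bool :=
  [&& is_partition lam, is_partition mu, size mu <= size lam &
      all (fun i => nth 0 mu i < nth 0 lam i) (iota 0 (size lam))].

(* Cells (i, j) are 1-based, hence the shift [i.-1] when reading off a part;
   missing parts are read as 0. *)
Definition cells (lam mu : seq nat) : seq (nat * nat) :=
  [seq (i, j) | i <- iota 1 (size lam),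
                j <- iota (nth 0 mu i.-1).+1
                          (nth 0 lam i.-1 - nth 0 mu i.-1)].

Definition diagram (lam mu : seq nat) : finType := seq_sub (cells lam mu).

Definition cell_row lam mu (c : diagram lam mu) : nat := (ssval c).1.
Definition cell_col lam mu (c : diagram lam mu) : nat := (ssval c).2.

Definition is_corner lam mu (c : diagram lam mu) : bool :=
  ((cell_row c, (cell_col c).+1) \notin cells lam mu) &&
  (((cell_row c).+1, cell_col c) \notin cells lam mu).

Definition filling lam mu := {ffun diagram lam mu -> nat}.

Definition semistandard lam mu (m : filling lam mu) : Prop :=
  [/\ forall c, 0 < m c,
      forall c d, cell_row c = cell_row d -> cell_col c < cell_col d ->
        m c <= m d
    & forall c d, cell_col c = cell_col d -> cell_row c < cell_row d ->
        m c < m d].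

(* [i + j] has the parity of [i - j]. *)
Definition is_checkerboard (a b : nat) lam mu (k : filling lam mu) : Prop :=
  (exists p : bool, forall c,
     k c = if odd (cell_row c + cell_col c) == p then b else a) /\
  (forall c, is_corner c -> k c = b).

Definition checkerboardable (a b : nat) lam mu : Prop :=
  exists k : filling lam mu, is_checkerboard a b k.

(* The constant filling is a dummy value for diagrams that are not
   checkerboardable. *)
Definition checkerboard (a b : nat) lam mu : filling lam mu :=
  xget [ffun=> b] [set k : filling lam mu | is_checkerboard a b k].

Definition delta (n : nat) : seq nat := rev (iota 1 n).

Definition S_outer (n : nat) : seq nat := n :: delta n.

Definition Sstar_outer (n : nat) : seq nat := rev (iota 2 n).

End SkewDiagrams.

Section SchurZeta.
Variable R : realType.

Definition schur_zeta lam mu (k : filling lam mu) : \bar R :=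
  \esum_(m in [set m : filling lam mu | semistandard m])
    (\prod_(c : diagram lam mu) ((m c)%:R : R) ^- k c)%:E.

Definition zeta_checkerboard (a b : nat) (lam mu : seq nat) : \bar R :=
  schur_zeta (checkerboard a b lam mu).

Definition S13 (n : nat) : \bar R :=
  zeta_checkerboard 1 3 (S_outer n) (delta n.-1).

Definition S13_star (n : nat) : \bar R :=
  zeta_checkerboard 1 3 (Sstar_outer n) (delta n.-1).

End SchurZeta.

Section SanityChecks.
Local Open Scope nat_scope.

Lemma mem_cells lam mu i j : ((i, j) \in cells lam mu) =
  (0 < i <= size lam) && (nth 0 mu i.-1 < j <= nth 0 lam i.-1).
Proof.
rewrite /cells; apply/allpairsPdep/idP => [[x [y [hx hy [-> ->]]]]|h].
  by move: hx hy; rewrite !mem_iota; lia.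
by exists i, j; rewrite !mem_iota; split=> //; lia.
Qed.

Lemma nth_delta n i : nth 0 (delta n) i = n - i.
Proof.
rewrite /delta; case: (ltnP i n) => h; last first.
  by rewrite nth_default ?size_rev ?size_iota //; lia.
by rewrite nth_rev size_iota // nth_iota; lia.
Qed.

Lemma nth_Sstar_outer n i :
  nth 0 (Sstar_outer n) i = if i < n then n.+1 - i else 0.
Proof.
rewrite /Sstar_outer; case: (ltnP i n) => h; last first.
  by rewrite nth_default ?size_rev ?size_iota //; lia.
by rewrite nth_rev size_iota // nth_iota; lia.
Qed.

Lemma is_partition_rev_iota m n : 0 < m -> is_partition (rev (iota m n)).
Proof.
move=> m0; rewrite /is_partition all_rev rev_sorted iota_sorted /=.
by apply/allP => x; rewrite mem_iota; lia.
Qed.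

Lemma is_skew_S n : 0 < n -> is_skew (S_outer n) (delta n.-1).
Proof.
move=> n0; apply/and4P; split.
- rewrite /S_outer /is_partition /= n0 /=.
  have /andP[s ->] := is_partition_rev_iota n (isT : 0 < 1).
  rewrite andbT (path_sortedE (rev_trans leq_trans)) s andbT.
  by apply/allP => x; rewrite mem_rev mem_iota /=; lia.
- exact: is_partition_rev_iota.
- by rewrite /= !size_rev !size_iota; lia.
- apply/allP => i; rewrite mem_iota /= size_rev size_iota nth_delta.
  by case: i => [|i] /=; rewrite ?nth_delta; lia.
Qed.

Lemma is_skew_Sstar n : 0 < n -> is_skew (Sstar_outer n) (delta n.-1).
Proof.
move=> n0; apply/and4P; split.
- exact: is_partition_rev_iota.
- exact: is_partition_rev_iota.
- by rewrite !size_rev !size_iota; lia.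
- apply/allP => i; rewrite mem_iota /= size_rev size_iota nth_delta.
  by rewrite nth_Sstar_outer; case: ifP; lia.
Qed.

Lemma has_corner lam mu (c : diagram lam mu) :
  exists d : diagram lam mu, is_corner d.
Proof.
pose f (d : diagram lam mu) := cell_row d + cell_col d.
have [d _ maxd] := @arg_maxnP _ c xpredT f isT.
exists d; apply/andP; split; apply/negP => h;
  by have := maxd (SeqSub h) isT; rewrite /f /cell_row /cell_col /=; lia.
Qed.

Lemma is_checkerboard_uniq a b lam mu (k l : filling lam mu) :
  is_checkerboard a b k -> is_checkerboard a b l -> k = l.
Proof.
move=> [[p hp] kb] [[q hq] lb]; apply/ffunP => c.
have [d dc] := has_corner c.
have := kb d dc; have := lb d dc; rewrite !hp !hq.
by move: (odd _) (odd _) p q {hp hq} => [] [] [] [] //= <-.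
Qed.

Lemma checkerboardable_S a b n : 0 < n ->
  checkerboardable a b (S_outer n) (delta n.-1).
Proof.
move=> n0.
exists [ffun c => if odd (cell_row c + cell_col c) == odd n then b else a].
split; first by exists (odd n) => c; rewrite ffunE.
move=> [[i j] h]; rewrite ffunE /is_corner /cell_row /cell_col /= => hc.
suff -> : i + j = n + 2 by rewrite oddD addbF eqxx.
move: h hc; rewrite !mem_cells /S_outer /= size_rev size_iota !nth_delta.
by case: i => [|[|i]]; rewrite /= ?nth_delta; lia.
Qed.

Lemma checkerboardable_Sstar a b n : 0 < n ->
  checkerboardable a b (Sstar_outer n) (delta n.-1).
Proof.
move=> n0.
exists [ffun c => if odd (cell_row c + cell_col c) == odd n then b else a].
split; first by exists (odd n) => c; rewrite ffunE.
move=> [[i j] h]; rewrite ffunE /is_corner /cell_row /cell_col /= => hc.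
suff -> : i + j = n + 2 by rewrite oddD addbF eqxx.
move: h hc; rewrite !mem_cells /= size_rev size_iota !nth_delta.
by rewrite !nth_Sstar_outer; do 2 case: ifP; lia.
Qed.

Lemma checkerboardP a b lam mu :
  checkerboardable a b lam mu -> is_checkerboard a b (checkerboard a b lam mu).
Proof. by case=> k hk; exact: (xgetI [ffun=> b] hk). Qed.

End SanityChecks.

(* Main.v *)
(* Cut all the entries at M. Both diagrams are ribbons, so their sums run over
   zigzags: p1 > q1 <= p2 > q2 <= ... > qn for S(n) and, read from the top right
   corner, p1 >= q1 < p2 >= ... >= qn for S*(n), with weights p^-3 and q^-1.

   Replacing the links between the blocks (p, q) by their negations inverts
   generating series up to the sign of X: with T the series of the strict chains
   p1 > q1 > p2 > ... and W that of the weak chains p1 >= q1 >= p2 >= ...,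
   S(X) T(-X) = 1 and S*(X) W(-X) = 1. Comparing the contributions of each value
   k to strict and to weak chains gives T(-X) = W(-X) prod_k (1 + X/k^4), hence
   S*(X) = S(X) prod_k (1 + X/k^4), which is (ii) once (i) is known.

   For (i) it remains to see that 4^n T(n) tends to zeta({4}^n), since then S(n)
   and 4^-n zeta*({4}^n) invert the same series. Put X = 4 u^2. The recurrence
   for T(-X) is solved by the partial sums of the Cauchy product of the
   coefficients of 2F1(sqrt u, - sqrt u; 1; t) and
   2F1(sqrt (-u), - sqrt (-u); 1; t), whose own partial sums are the
   prod_(k <= M) (1 - u/k^2) and prod_(k <= M) (1 + u/k^2). In the limit the
   Cauchy product becomes the product prod_k (1 - u^2/k^4). *)

From HB Require Import structures.
Require Import Defs.
From mathcomp Require Import ring lra zify.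
Set Implicit Arguments.
Unset Strict Implicit.
Unset Printing Implicit Defensive.
Import Order.TTheory GRing.Theory Num.Theory.
Import numFieldNormedType.Exports.
Local Open Scope ring_scope.
Local Open Scope classical_set_scope.

(** * Formal power series over a commutative ring *)

Definition fps (A : Type) := nat -> A.

Section FpsRing.
Variable A : comNzRingType.
Implicit Types f g h : fps A.

HB.instance Definition _ := gen_eqMixin (fps A).
HB.instance Definition _ := gen_choiceMixin (fps A).

Definition fps_zero : fps A := fun=> 0.
Definition fps_opp f : fps A := fun n => - f n.
Definition fps_add f g : fps A := fun n => f n + g n.
Definition fps_one : fps A := fun n => (n == 0%N)%:R.
Definition fps_mul f g : fps A := fun n => \sum_(i < n.+1) f i * g (n - i)%N.

Fact fps_addA : associative fps_add.
Proof. by move=> f g h; apply/funext => n; exact: addrA. Qed.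
Fact fps_addC : commutative fps_add.
Proof. by move=> f g; apply/funext => n; exact: addrC. Qed.
Fact fps_add0 : left_id fps_zero fps_add.
Proof. by move=> f; apply/funext => n; exact: add0r. Qed.
Fact fps_addN : left_inverse fps_zero fps_opp fps_add.
Proof. by move=> f; apply/funext => n; exact: addNr. Qed.

HB.instance Definition _ :=
  GRing.isZmodule.Build (fps A) fps_addA fps_addC fps_add0 fps_addN.

(** Commutativity and associativity of convolution are inherited from polynomials: the coefficients
    of a product up to degree [N] only involve those of the factors up to degree [N]. *)
Let trunc N f : {poly A} := \poly_(i < N.+1) f i.

Let trunc_mul N n f g : (n <= N)%N ->
  (trunc N f * trunc N g)`_n = fps_mul f g n.
Proof.
move=> nN; rewrite coefM; apply: eq_bigr => i _.
by rewrite !coef_poly !ifT //; have := ltn_ord i; lia.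
Qed.

Fact fps_mulC : commutative fps_mul.
Proof.
by move=> f g; apply/funext => n; rewrite -!(trunc_mul _ _ (leqnn n)) mulrC.
Qed.

Fact fps_mulA : associative fps_mul.
Proof.
move=> f g h; apply/funext => n.
transitivity ((trunc n f * trunc n g * trunc n h)`_n).
  rewrite -mulrA coefM; apply: eq_bigr => i _.
  by rewrite trunc_mul ?leq_subr// coef_poly ltn_ord.
rewrite coefM; apply: eq_bigr => i _.
by rewrite trunc_mul ?leq_ord// coef_poly ifT // ltnS leq_subr.
Qed.

Fact fps_mul1 : left_id fps_one fps_mul.
Proof.
move=> f; apply/funext => n; rewrite /fps_mul big_ord_recl /= subn0 mul1r.
by rewrite big1 ?addr0 // => i _; rewrite /fps_one /= mul0r.
Qed.

Fact fps_mulDl : left_distributive fps_mul fps_add.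
Proof.
move=> f g h; apply/funext => n; rewrite /fps_mul /fps_add -big_split /=.
by apply: eq_bigr => i _; rewrite mulrDl.
Qed.

Fact fps_one_neq0 : fps_one != 0.
Proof.
by apply/eqP => /(congr1 (fun f : fps A => f 0%N)) /eqP; rewrite oner_eq0.
Qed.

HB.instance Definition _ := GRing.Zmodule_isComNzRing.Build (fps A)
  fps_mulA fps_mulC fps_mul1 fps_mulDl fps_one_neq0.

Lemma fpsD f g n : (f + g) n = f n + g n. Proof. by []. Qed.
Lemma fpsN f n : (- f) n = - f n. Proof. by []. Qed.
Lemma fps1 n : (1 : fps A) n = (n == 0%N)%:R. Proof. by []. Qed.
Lemma fpsM f g n : (f * g) n = \sum_(i < n.+1) f i * g (n - i)%N.
Proof. by []. Qed.

Definition fpsC (c : A) : fps A := fun n => if n is 0%N then c else 0.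
Definition fpsX : fps A := fun n => (n == 1%N)%:R.

Lemma fpsCM c f n : (fpsC c * f) n = c * f n.
Proof.
by rewrite fpsM big_ord_recl subn0 big1 ?addr0 // => i _; rewrite mul0r.
Qed.

Lemma fpsXM f n : (fpsX * f) n = if n is k.+1 then f k else 0.
Proof.
rewrite fpsM; case: n => [|n]; first by rewrite big_ord1 mul0r.
rewrite 2!big_ord_recl big1 ?addr0; last by move=> i _; rewrite mul0r.
by rewrite mul0r add0r mul1r subSS subn0.
Qed.

(* Euler's operator [X d/dX]. *)
Definition fps_euler f : fps A := fun n => n%:R * f n.

Lemma fps_eulerD f g : fps_euler (f + g) = fps_euler f + fps_euler g.
Proof. by apply/funext => n; exact: mulrDr. Qed.
Lemma fps_eulerN f : fps_euler (- f) = - fps_euler f.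
Proof. by apply/funext => n; exact: mulrN. Qed.
Lemma fps_eulerM f g : fps_euler (f * g) = fps_euler f * g + f * fps_euler g.
Proof.
apply/funext => n; rewrite fpsD !fpsM /fps_euler mulr_sumr -big_split /=.
apply: eq_bigr => i _; rewrite -{1}(subnKC (leq_ord i)) natrD; ring.
Qed.
Lemma fps_euler_C c f : fps_euler (fpsC c * f) = fpsC c * fps_euler f.
Proof. by apply/funext => n; rewrite /fps_euler !fpsCM; ring. Qed.

Lemma fps_1BX_inj f g : (1 - fpsX) * f = (1 - fpsX) * g -> f = g.
Proof.
move=> h; apply/funext; elim=> [|n ih].
  by have := congr1 (fun k : fps A => k 0%N) h;
    rewrite !mulrBl !mul1r !fpsD !fpsN !fpsXM !subr0.
have := congr1 (fun k : fps A => k n.+1) h.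
by rewrite !mulrBl !mul1r !fpsD !fpsN !fpsXM ih => /addIr.
Qed.

End FpsRing.
Arguments fpsX {A}.

(** * The generating function of the zeta values at (3,1,...,3,1) *)

Section HypergeometricProduct.
(** [A] will itself be a ring of power series with [u] its variable. As it is not a field, [iv n]
    stands for 1/(n+1). *)
Variables (A : comNzRingType) (iv : nat -> A).
Hypothesis ivP : forall n, iv n * n.+1%:R = 1.
Implicit Types (u v : A) (n : nat).

Let natS_inj n (p q : A) : n.+1%:R * p = n.+1%:R * q -> p = q.
Proof. by move=> h; rewrite -(mul1r p) -(mul1r q) -(ivP n) -!mulrA h. Qed.

(* The Taylor coefficients of the hypergeometric function
   [2F1(sqrt v, - sqrt v; 1; t)]. *)
Fixpoint hyp_coef v n : A :=
  if n is k.+1 then iv k ^+ 2 * (k%:R ^+ 2 - v) * hyp_coef v k else 1.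

Definition hyp v : fps A := hyp_coef v.

Let hypS v k : hyp v k.+1 = iv k ^+ 2 * (k%:R ^+ 2 - v) * hyp v k.
Proof. by []. Qed.

Arguments hyp : simpl never.

(** On coefficients this is (n+1)^2 c_(n+1) = (n^2 - v) c_n, the recurrence of [hyp_coef] cleared of
    denominators. *)
Lemma hyp_ode v :
  (1 - fpsX) * fps_euler (fps_euler (hyp v)) = - (fpsC v * (fpsX * hyp v)).
Proof.
apply/funext => -[|n]; rewrite mulrBl mul1r fpsD !fpsN fpsCM !fpsXM /fps_euler.
  by rewrite !mul0r mulr0 subr0 oppr0.
have -> : n.+1%:R * (n.+1%:R * hyp v n.+1) =
    (iv n * n.+1%:R) ^+ 2 * ((n%:R ^+ 2 - v) * hyp v n).
  by rewrite hypS; ring.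
by rewrite ivP; ring.
Qed.

(** The effect of allowing one more value, n+1, at the top of strict alternating chains: [p.1]
    collects those that are empty or begin with weight k^-3, [p.2] those that begin with k^-1. Each
    pair carries a factor - u. *)
Definition strict_step u n (p : A * A) : A * A :=
  (p.1 - u * iv n ^+ 3 * p.2, p.2 + iv n * p.1).

Fixpoint strict_gf u n : A * A :=
  if n is k.+1 then strict_step u k (strict_gf u k) else (1, 0).

(* With [w = y z] where [(1-t) y'' = - u t y] and [(1-t) z'' = u t z]
   (primes being Euler's operator), [w'' = 2 y' z'], then
   [(1-t) w''' = 2 u t (z y' - y z')] and
   [(1-t) (2 u (z y' - y z'))' = - 4 u^2 t w]. *)
Lemma strict_gf_hyp u n :
  (strict_gf (4%:R * u ^+ 2) n).1 = \sum_(i < n.+1) (hyp u * hyp (- u)) i.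
Proof.
set y := hyp u; set z := hyp (- u); set w := y * z.
have yE := hyp_ode u; rewrite -/y in yE.
have zE := hyp_ode (- u); rewrite -/z in zE.
have CN : fpsC (- u) = - fpsC u.
  by apply/funext => -[|k] //; rewrite fpsN /= oppr0.
rewrite {}CN in zE.
have w2 : fps_euler (fps_euler w) =
    fps_euler y * fps_euler z + fps_euler y * fps_euler z.
  apply: fps_1BX_inj.
  rewrite /w !(fps_eulerM, fps_eulerD).
  move: yE zE; set y1 := fps_euler y; set y2 := fps_euler y1.
  set z1 := fps_euler z; set z2 := fps_euler z1 => yE zE.
  have -> : (1 - fpsX) * (y2 * z + y1 * z1 + (y1 * z1 + y * z2)) =
    (1 - fpsX) * y2 * z + y * ((1 - fpsX) * z2) +
      (1 - fpsX) * (y1 * z1 + y1 * z1) by ring.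
  by rewrite yE zE; ring.
pose g0 := z * fps_euler y - y * fps_euler z.
pose g := fpsC u * (g0 + g0).
have w3 : (1 - fpsX) * fps_euler (fps_euler (fps_euler w)) = fpsX * g.
  rewrite w2 !(fps_eulerM, fps_eulerD) /g /g0.
  move: yE zE; set y1 := fps_euler y; set y2 := fps_euler y1.
  set z1 := fps_euler z; set z2 := fps_euler z1 => yE zE.
  have -> : (1 - fpsX) * (y2 * z1 + y1 * z2 + (y2 * z1 + y1 * z2)) =
    (1 + 1) * ((1 - fpsX) * y2 * z1 + y1 * ((1 - fpsX) * z2)) by ring.
  by rewrite yE zE; ring.
have g1 : (1 - fpsX) * fps_euler g =
    fpsX * (fpsC (- (4%:R * u ^+ 2)) * w).
  have -> : fpsC (- (4%:R * u ^+ 2)) =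
      - ((1 + 1) * ((1 + 1) * (fpsC u * fpsC u))) :> fps A.
    by apply/funext => -[|k]; rewrite fpsN !mulrDl !mul1r !fpsD !fpsCM /=; ring.
  rewrite /g fps_euler_C fps_eulerD /g0 fps_eulerD fps_eulerN !fps_eulerM /w.
  move: yE zE; set y1 := fps_euler y; set y2 := fps_euler y1.
  set z1 := fps_euler z; set z2 := fps_euler z1 => yE zE.
  have -> : (1 - fpsX) * (fpsC u * (z1 * y1 + z * y2 - (y1 * z1 + y * z2) +
      (z1 * y1 + z * y2 - (y1 * z1 + y * z2)))) =
    (1 + 1) * fpsC u * (z * ((1 - fpsX) * y2) - y * ((1 - fpsX) * z2)) by ring.
  by rewrite yE zE; ring.
(* Read on coefficients, [w3] makes [g k] a difference of consecutive k^3 w_k, and [g1] then makes k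
   g_k a multiple of a partial sum of [w]. *)
have gE k : g k = k.+1%:R ^+ 3 * w k.+1 - k%:R ^+ 3 * w k.
  have := congr1 (fun f : fps A => f k.+1) w3.
  by rewrite mulrBl mul1r fpsD fpsN !fpsXM /fps_euler => <-; ring.
have gS k : k%:R * g k = - (4%:R * u ^+ 2) * \sum_(i < k) w i.
  elim: k => [|k ih]; first by rewrite big_ord0 mulr0 mul0r.
  have := congr1 (fun f : fps A => f k.+1) g1.
  rewrite mulrBl mul1r fpsD fpsN !fpsXM fpsCM /fps_euler ih => h.
  by rewrite big_ord_recr /= mulrDr -h; ring.
(* The second component is carried along because, up to a factor, it supplies the next coefficient
   of [w]. *)
suff [] : (strict_gf (4%:R * u ^+ 2) n).1 = \sum_(i < n.+1) w i /\
  - (4%:R * u ^+ 2) * (strict_gf (4%:R * u ^+ 2) n).2 = n.+1%:R ^+ 3 * w n.+1.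
  by [].
elim: n => [|n [ih1 ih2]].
  rewrite big_ord1 /= mulr0; split.
    by rewrite /w fpsM big_ord1 mul1r.
  have := gE 0%N; rewrite expr0n mul0r subr0 => <-.
  rewrite /g fpsCM /g0 !fpsD fpsN !fpsM !big_ord1 /fps_euler.
  by rewrite !(mul0r, mulr0) subrr addr0 mulr0.
rewrite /=; split.
  rewrite ih1 [RHS]big_ord_recr; congr (_ + _).
  have -> : - (4%:R * u ^+ 2 * iv n ^+ 3 * (strict_gf (4%:R * u ^+ 2) n).2) =
    iv n ^+ 3 * (- (4%:R * u ^+ 2) * (strict_gf (4%:R * u ^+ 2) n).2) by ring.
  by rewrite ih2 mulrA -exprMn ivP expr1n mul1r.
apply: (natS_inj (n := n)); rewrite mulrDr ih2 mulrA mulrAC.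
have := gS n.+1; rewrite gE -ih1 => h.
transitivity (n.+1%:R * (n.+1%:R ^+ 3 * w n.+1) + iv n * n.+1%:R *
   (- (4%:R * u ^+ 2) * (strict_gf (4%:R * u ^+ 2) n).1)).
  by ring.
by rewrite ivP -h; ring.
Qed.

(** The coefficient of index n+1 is exactly what the partial product gains from its next factor, so
    the partial sums at t = 1 are partial Euler products. *)
Lemma sum_hyp v n :
  \sum_(i < n.+1) hyp v i = \prod_(i < n) (1 - v * iv i ^+ 2) /\
  hyp v n.+1 = - v * iv n ^+ 2 * \prod_(i < n) (1 - v * iv i ^+ 2).
Proof.
elim: n => [|n [ih1 ih2]].
  by rewrite big_ord1 big_ord0 hypS; split=> //; rewrite [hyp v 0]/hyp /=; ring.
rewrite big_ord_recr ih1 !big_ord_recr /=; split.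
  by rewrite ih2; ring.
rewrite hypS ih2.
transitivity (iv n.+1 ^+ 2 * ((iv n * n.+1%:R) ^+ 2 - v * iv n ^+ 2) *
  - v * \prod_(i < n) (1 - v * iv i ^+ 2)); first by ring.
by rewrite ivP; ring.
Qed.

End HypergeometricProduct.

(** * Truncated chain sums *)

Definition rel_any : rel nat := fun _ _ => true.
Definition rel_le : rel nat := fun x y => (x <= y)%N.
Definition rel_lt : rel nat := fun x y => (x < y)%N.
Definition rel_ge : rel nat := fun x y => (y <= x)%N.
Definition rel_gt : rel nat := fun x y => (y < x)%N.

Section ChainSums.
Variable A : comNzRingType.
Implicit Types (M n k j x : nat) (w : nat -> A).

(* A link [(r, w)] adds an entry [y] of weight [w y], related by [r] to the
   preceding entry. *)
Local Notation links := (seq (rel nat * (nat -> A))).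
Implicit Types (s t : links) (ws : seq (nat -> A)).

Fixpoint csum M s x : A :=
  if s is (r, w) :: s' then
    \sum_(1 <= y < M.+1 | r x y) w y * csum M s' y
  else 1.

(** Meant for a tail [t] that begins with a free link: its sum does not see the preceding entry and
    factors out. *)
Lemma csum_cat_const M s t c x :
  (forall y, csum M t y = c) -> csum M (s ++ t) x = csum M s x * c.
Proof.
move=> tc; elim: s x => [|[r w] s ih] x /=; first by rewrite mul1r.
by rewrite mulr_suml; apply: eq_bigr => y _; rewrite ih mulrA.
Qed.

Lemma csum_catD M s t t1 t2 x :
  (forall y, csum M t y = csum M t1 y + csum M t2 y) ->
  csum M (s ++ t) x = csum M (s ++ t1) x + csum M (s ++ t2) x.
Proof.
move=> tD; elim: s x => [|[r w] s ih] x /=; first exact: tD.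
by rewrite -big_split; apply: eq_bigr => y _; rewrite ih mulrDr.
Qed.

Lemma iter_cat T k (B t : seq T) :
  iter k (cat B) t = iter k (cat B) [::] ++ t.
Proof. by elim: k => //= k ->; rewrite catA. Qed.

Section Zigzag.
Variables (w0 : nat -> A) (tl : links).

Definition block (r : rel nat) : links := (r, w0) :: tl.

(** The first entry has no predecessor, so its link is free and the starting value 0 used below is
    arbitrary. *)
Definition zigzag (r : rel nat) n : links :=
  if n is k.+1 then block rel_any ++ iter k (cat (block r)) [::] else [::].

Definition zigzag_gf (r : rel nat) M : fps A := fun n => csum M (zigzag r n) 0.
Definition zigzag_gfN (r : rel nat) M : fps A :=
  fun n => (-1) ^+ n * csum M (zigzag r n) 0.

(* A free link is the disjoint union of a link [r] and a link [r'], so the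
   products of coefficients telescope. *)
Lemma zigzag_compl (r r' : rel nat) M : (forall x y, r' x y = ~~ r x y) ->
  zigzag_gf r M * zigzag_gfN r' M = 1.
Proof.
move=> rr'; apply/funext => -[|n].
  by rewrite fpsM big_ord1 /zigzag_gf /zigzag_gfN /= !mul1r.
rewrite fps1 /=.
(* [V k j] sums over k+j+1 blocks, the first k junctions being of type [r] and the last j of type
   [r']. Concatenating two zigzags leaves a free junction, which [VM] splits into these two
   types. *)
pose V k j := csum M (block rel_any ++ iter k (cat (block r))
  (iter j (cat (block r')) [::])) 0.
have VM k j : zigzag_gf r M k.+1 * csum M (zigzag r' j.+1) 0 =
    V k.+1 j + V k j.+1.
  transitivity (csum M (zigzag r k.+1 ++ zigzag r' j.+1) 0).
    symmetry; apply: csum_cat_const => y; done.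
  have VE t : block rel_any ++ iter k (cat (block r)) t = zigzag r k.+1 ++ t.
    by rewrite iter_cat catA.
  rewrite /V iterSr !VE; apply: csum_catD => y.
  rewrite [LHS](bigID (r y)) /=; congr (_ + _).
  by apply: eq_bigl => z; rewrite rr'.
(* The inner terms of the coefficient of index n+1 are differences of [a]; the two end terms, where
   one factor is empty, are - a_0 and a_n. *)
pose a k := (-1) ^+ (n - k) * V k (n - k)%N.
rewrite fpsM big_ord_recl big_ord_recr /= /zigzag_gfN subnn.
transitivity (- a 0%N + (\sum_(0 <= k < n) - (a k.+1 - a k) + a n)); last first.
  rewrite sumrN telescope_sumr //; ring.
congr (_ + (_ + _)).
- by rewrite [zigzag_gf r M _]/(1 : A) mul1r /a !subn0 exprS mulN1r mulNr.
- rewrite big_mkord; apply: eq_bigr => i _.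
  rewrite /bump /= add1n subSS.
  have -> : (n - i = (n - i.+1).+1)%N by have := ltn_ord i; lia.
  rewrite mulrCA VM /a.
  have -> : (n - i = (n - i.+1).+1)%N by have := ltn_ord i; lia.
  by rewrite exprS; ring.
- by rewrite ?/bump ?add1n ?subnn /a ?subnn !expr0 !mul1r mulr1.
Qed.

End Zigzag.

Section Descending.

Lemma csum_gt0 M w s : csum M ((rel_gt, w) :: s) 1 = 0.
Proof. by rewrite /= big_nat_cond big1 // => y; rewrite /rel_gt; lia. Qed.

Lemma csum_ge0 M w s : csum M ((rel_ge, w) :: s) 0 = 0.
Proof. by rewrite /= big_nat_cond big1 // => y; rewrite /rel_ge; lia. Qed.

Lemma csum_gtS M w s x : (x < M)%N -> csum M ((rel_gt, w) :: s) x.+2 =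
  csum M ((rel_gt, w) :: s) x.+1 + w x.+1 * csum M s x.+1.
Proof.
have e (z : nat) : (z <= M)%N -> csum M ((rel_gt, w) :: s) z.+1 =
    \sum_(1 <= y < z.+1) w y * csum M s y.
  move=> zM; rewrite /= [RHS](big_nat_widen _ _ M.+1) //.
move=> xM; rewrite !e //; last exact: ltnW.
by rewrite big_nat_recr.
Qed.

(** [rel_gt] at x+1 and [rel_ge] at x both bound the entry by x and are convertible. Hence the shift
    by one between strict and weak statements below. *)
Lemma csum_geS M w s x : (x < M)%N -> csum M ((rel_ge, w) :: s) x.+1 =
  csum M ((rel_ge, w) :: s) x + w x.+1 * csum M s x.+1.
Proof. exact: (@csum_gtS M w s x). Qed.

Lemma csum_any_gt M w s x :
  csum M ((rel_any, w) :: s) x = csum M ((rel_gt, w) :: s) M.+1.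
Proof.
by rewrite /= big_nat_cond [RHS]big_nat_cond; apply: eq_bigl => y;
  rewrite /rel_any /rel_gt; lia.
Qed.

Lemma csum_any_ge M w s x :
  csum M ((rel_any, w) :: s) x = csum M ((rel_ge, w) :: s) M.
Proof. exact: csum_any_gt. Qed.

Variables (wa wb : nat -> A) (M : nat).

(** For x <= M, the elementary symmetric functions of the wa_k wb_k with 1 <= k <= x, that is, the
    partial product of the 1 + X wa_k wb_k. *)
Definition pow_gf x : fps A := fun n =>
  csum M (iter n (cat [:: (rel_gt, fun k => wa k * wb k)]) [::]) x.+1.

Lemma pow_gf0 : pow_gf 0 = 1.
Proof. by apply/funext => -[|n] //; rewrite /pow_gf csum_gt0. Qed.

Lemma pow_gfS x : (x < M)%N ->
  pow_gf x.+1 = (1 + fpsX * fpsC (wa x.+1 * wb x.+1)) * pow_gf x.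
Proof.
move=> xM; apply/funext => n; rewrite mulrDl mul1r -mulrA fpsD fpsXM.
case: n => [|n]; first by rewrite /pow_gf /= addr0.
by rewrite fpsCM {1}/pow_gf iterS csum_gtS.
Qed.

(** Signed series of the descending chains of even length ([desc_gf]) and of odd length ([desc_gf'],
    with an extra leading entry of weight [wa]). The bound [x] on the first entry is the variable of
    the induction; [M] stays fixed. *)
Definition desc_gf (r : rel nat) x : fps A := fun n => (-1) ^+ n *
  csum M (iter n (cat (block wb [:: (r, wa)] r)) [::]) x.
Definition desc_gf' (r : rel nat) x : fps A := fun n => (-1) ^+ n *
  csum M ((r, wa) :: iter n (cat (block wb [:: (r, wa)] r)) [::]) x.

Lemma strict_desc_gfS x : (x < M)%N ->
  desc_gf rel_gt x.+2 =
    desc_gf rel_gt x.+1 - fpsX * (fpsC (wb x.+1) * desc_gf' rel_gt x.+1) /\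
  desc_gf' rel_gt x.+2 =
    desc_gf' rel_gt x.+1 + fpsC (wa x.+1) * desc_gf rel_gt x.+1.
Proof.
move=> xM; split; apply/funext => n; last first.
  by rewrite fpsD fpsCM /desc_gf' csum_gtS //= /desc_gf; ring.
rewrite fpsD fpsN fpsXM; case: n => [|n].
  by rewrite /desc_gf /= oppr0 addr0.
rewrite fpsCM {1}/desc_gf iterS csum_gtS // /desc_gf /desc_gf' iterS.
rewrite [cat _ _]/= exprS; ring.
Qed.

Lemma weak_desc_gfS x : (x < M)%N ->
  desc_gf rel_ge x.+1 =
    desc_gf rel_ge x - fpsX * (fpsC (wb x.+1) * desc_gf' rel_ge x.+1) /\
  desc_gf' rel_ge x.+1 =
    desc_gf' rel_ge x + fpsC (wa x.+1) * desc_gf rel_ge x.+1.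
Proof.
move=> xM; split; apply/funext => n; last first.
  by rewrite fpsD fpsCM /desc_gf' csum_geS //= /desc_gf; ring.
rewrite fpsD fpsN fpsXM; case: n => [|n].
  by rewrite /desc_gf /= oppr0 addr0.
rewrite fpsCM {1}/desc_gf iterS csum_geS // /desc_gf /desc_gf' iterS.
rewrite [cat _ _]/= exprS; ring.
Qed.

Lemma desc_gf0 : [/\ desc_gf rel_gt 1 = 1, desc_gf' rel_gt 1 = 0,
  desc_gf rel_ge 0 = 1 & desc_gf' rel_ge 0 = 0].
Proof.
split; apply/funext => n.
- by case: n => [|n]; rewrite /desc_gf ?iterS ?csum_gt0 ?mulr0 ?mul1r.
- by rewrite /desc_gf' csum_gt0 mulr0.
- by case: n => [|n]; rewrite /desc_gf ?iterS ?csum_ge0 ?mulr0 ?mul1r.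
- by rewrite /desc_gf' csum_ge0 mulr0.
Qed.

(* The entries equal to [k] contribute [1 + N] to a strict chain and
   [1 / (1 - N) = (1 + N) / (1 + X wa_k wb_k)] to a weak one, where [N] is the
   matrix with rows [(0, - X wb_k)] and [(wa_k, 0)]. *)
Lemma strict_weak_desc x : (x <= M)%N ->
  desc_gf rel_gt x.+1 = pow_gf x * desc_gf rel_ge x /\
  desc_gf' rel_gt x.+1 = pow_gf x * desc_gf' rel_ge x.
Proof.
elim: x => [|x ih] xM.
  have [-> -> -> ->] := desc_gf0.
  by rewrite pow_gf0 mulr1 mulr0.
have {ih}[ih1 ih2] := ih (ltnW xM).
have [s1 s2] := strict_desc_gfS xM; have [d1 d2] := weak_desc_gfS xM.
rewrite s1 s2 ih1 ih2 pow_gfS //.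
have -> : fpsC (wa x.+1 * wb x.+1) = fpsC (wa x.+1) * fpsC (wb x.+1) :> fps A.
  by apply/funext => -[|n]; rewrite fpsCM //= mulr0.
set a := fpsC (wa _) in d2 *; set b := fpsC (wb _) in d1 *.
(* The weak step is implicit: (1 - N) v_(x+1) = v_x. Multiplying by 1 + N solves it, since 1 - N^2
   is the scalar 1 + X a b. *)
have e1 : (1 + fpsX * (a * b)) * desc_gf rel_ge x.+1 =
    desc_gf rel_ge x - fpsX * (b * desc_gf' rel_ge x).
  by rewrite mulrDl mul1r {1}d1 d2; ring.
have e2 : (1 + fpsX * (a * b)) * desc_gf' rel_ge x.+1 =
    desc_gf' rel_ge x + a * desc_gf rel_ge x.
  by rewrite mulrDl mul1r {1}d2 d1; ring.
by split; rewrite mulrAC ?e1 ?e2; ring.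
Qed.

Lemma zigzag_gfN_gt :
  zigzag_gfN wb [:: (rel_gt, wa)] rel_gt M = desc_gf rel_gt M.+1.
Proof.
apply/funext => -[|n] //; rewrite /zigzag_gfN /desc_gf; congr (_ * _).
by rewrite [LHS]csum_any_gt.
Qed.

Lemma zigzag_gfN_ge :
  zigzag_gfN wb [:: (rel_ge, wa)] rel_ge M = desc_gf rel_ge M.
Proof.
apply/funext => -[|n] //; rewrite /zigzag_gfN /desc_gf; congr (_ * _).
by rewrite [LHS]csum_any_ge.
Qed.

Lemma zigzag_gf_pow :
  zigzag_gf (fun k => wa k * wb k) [::] rel_gt M = pow_gf M.
Proof.
apply/funext => -[|n] //; rewrite /zigzag_gf /pow_gf.
by rewrite [LHS]csum_any_gt.
Qed.

(** By [zigzag_compl] the two zigzag series are the inverses of the weak and of the strict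
    descending series, which [strict_weak_desc] compares. The identity is exact at every truncation
    [M]. *)
Lemma zigzag_gf_star :
  zigzag_gf wb [:: (rel_ge, wa)] rel_lt M =
    zigzag_gf wb [:: (rel_gt, wa)] rel_le M *
    zigzag_gf (fun k => wa k * wb k) [::] rel_gt M.
Proof.
have S1 := @zigzag_compl wb [:: (rel_gt, wa)] rel_le rel_gt M
  (fun x y => ltnNge y x).
have Y1 := @zigzag_compl wb [:: (rel_ge, wa)] rel_lt rel_ge M
  (fun x y => leqNgt y x).
move: S1 Y1; rewrite zigzag_gfN_gt zigzag_gfN_ge zigzag_gf_pow.
have [-> _] := strict_weak_desc (leqnn M).
set S := zigzag_gf _ _ rel_le _; set Y := zigzag_gf _ _ rel_lt _ => S1 Y1.
have -> : Y = Y * (S * (pow_gf M * desc_gf rel_ge M)) by rewrite S1 mulr1.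
have -> : Y * (S * (pow_gf M * desc_gf rel_ge M)) =
  Y * desc_gf rel_ge M * (S * pow_gf M) by ring.
by rewrite Y1 mul1r.
Qed.

End Descending.

End ChainSums.

(** * Coefficientwise limits *)

Section FpsLimits.
Variable R : realType.
Implicit Types (f g h : fps R) (F G : nat -> fps R) (M n : nat).

Definition fps_cvg F f := forall n, F M n @[M --> \oo] --> f n.

Lemma fps_cvg_sum n (u : nat -> nat -> R) (l : nat -> R) :
  (forall i, (i < n)%N -> u M i @[M --> \oo] --> l i) ->
  \sum_(i < n) u M i @[M --> \oo] --> \sum_(i < n) l i.
Proof.
move=> ul; apply: cvg_big => [|i _]; last exact: ul.
exact: add_continuous.
Qed.

Lemma fps_cvgM F G f g :
  fps_cvg F f -> fps_cvg G g -> fps_cvg (fun M => F M * G M) (f * g).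
Proof.
move=> Ff Gg n.
apply: (@fps_cvg_sum n.+1 (fun M i => F M i * G M (n - i)%N)
  (fun i => f i * g (n - i)%N)) => i _.
by apply: cvgM; [exact: Ff|exact: Gg].
Qed.

Lemma fps_cvgD F G f g :
  fps_cvg F f -> fps_cvg G g -> fps_cvg (fun M => F M + G M) (f + g).
Proof. by move=> Ff Gg n; apply: cvgD; [exact: Ff|exact: Gg]. Qed.

Lemma fps_cvgN F f : fps_cvg F f -> fps_cvg (fun M => - F M) (- f).
Proof. by move=> Ff n; apply: cvgN; exact: Ff. Qed.

Lemma fps_cvg_unique F f g : fps_cvg F f -> fps_cvg F g -> f = g.
Proof.
by move=> Ff Fg; apply/funext => n; exact: (cvg_unique _ (Ff n) (Fg n)).
Qed.

(** As the constant coefficients of [F M] are 1, the inverse satisfies a triangular recurrence, and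
    its coefficients converge by strong induction. *)
Lemma fps_cvg_inv F G f :
  (forall M, F M 0%N = 1) -> (forall M, G M * F M = 1) ->
  fps_cvg F f -> exists2 g, fps_cvg G g & g * f = 1.
Proof.
move=> F0 GF Ff.
have GE M n : G M n = (n == 0%N)%:R - \sum_(i < n) G M i * F M (n - i)%N.
  have := congr1 (fun h : fps R => h n) (GF M).
  rewrite fpsM fps1 big_ord_recr subnn F0 mulr1 => /= <-.
  by rewrite addrC addrK.
have Gc n : exists l : R, G M n @[M --> \oo] --> l.
  elim/ltn_ind: n => n ih.
  have [l lP] : exists l : nat -> R, forall i, (i < n)%N ->
      G M i @[M --> \oo] --> l i.
    exists (fun i => lim (G M i @[M --> \oo])) => i /ih [l Gl].
    by rewrite (cvg_lim _ Gl).
  eexists; under eq_cvg do rewrite GE.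
  apply: cvgB; first exact: cvg_cst.
  apply: (@fps_cvg_sum n (fun M i => G M i * F M (n - i)%N)
    (fun i => l i * f (n - i)%N)) => i ni.
  by apply: cvgM; [exact: lP|exact: Ff].
pose g : fps R := fun n => lim (G M n @[M --> \oo]).
have Gg : fps_cvg G g.
  by move=> n; have [l Gl] := Gc n; rewrite /g (cvg_lim _ Gl).
exists g => //; apply: (fps_cvg_unique (fps_cvgM Gg Ff)).
move=> n; under eq_cvg do rewrite GF.
exact: cvg_cst.
Qed.

(** Cauchy's majorants. They respect sums and products, which reduces estimates on signed series to
    series with nonnegative coefficients. *)
Definition fps_maj f g := forall n, `|f n| <= g n.

Lemma fps_maj0 : fps_maj 0 0.
Proof. by move=> n; rewrite normr0. Qed.

Lemma fps_majD f f' g g' :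
  fps_maj f g -> fps_maj f' g' -> fps_maj (f + f') (g + g').
Proof. by move=> fg fg' n; apply: le_trans (ler_normD _ _) _; exact: lerD. Qed.

Lemma fps_maj_ge0 f g n : fps_maj f g -> 0 <= g n.
Proof. by move=> /(_ n); exact: le_trans. Qed.

Lemma fps_majDr f g h :
  fps_maj f g -> (forall n, 0 <= h n) -> fps_maj f (g + h).
Proof. by move=> fg h0 n; rewrite fpsD (le_trans (fg n))// lerDl. Qed.

Lemma fps_majM f f' g g' :
  fps_maj f g -> fps_maj f' g' -> fps_maj (f * f') (g * g').
Proof.
move=> fg fg' n; rewrite !fpsM; apply: le_trans (ler_norm_sum _ _ _) _.
by apply: ler_sum => i _; rewrite normrM ler_pM.
Qed.

Lemma fps_maj_sum (I : Type) (r : seq I) (P : pred I) (F G : I -> fps R) :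
  (forall i, P i -> fps_maj (F i) (G i)) ->
  fps_maj (\sum_(i <- r | P i) F i) (\sum_(i <- r | P i) G i).
Proof.
move=> FG; apply: (big_ind2 fps_maj) => //; first exact: fps_maj0.
by move=> f f1 g g1 h h1; exact: fps_majD.
Qed.

Lemma fps_majX (c d : R) : `|c| <= d -> fps_maj (fpsX * fpsC c) (fpsX * fpsC d).
Proof.
by move=> cd [|[|n]]; rewrite !fpsXM /= ?normr0.
Qed.

Lemma fps_maj1 : fps_maj 1 1.
Proof. by move=> n; rewrite fps1 normr_nat. Qed.

Definition eprod (c : nat -> R) M : fps R :=
  \prod_(i < M) (1 + fpsX * fpsC (c i)).

Lemma eprodS c M : eprod c M.+1 = eprod c M * (1 + fpsX * fpsC (c M)).
Proof. exact: big_ord_recr. Qed.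

Lemma eprod_maj c d : (forall i, `|c i| <= d i) ->
  forall M, fps_maj (eprod c M) (eprod d M).
Proof.
move=> cd; elim=> [|M ih].
  by rewrite /eprod !big_ord0; exact: fps_maj1.
rewrite !eprodS; apply: fps_majM => //.
by apply: fps_majD; [exact: fps_maj1|exact: fps_majX].
Qed.

Lemma eprod_coefS c M n : eprod c M.+1 n =
  eprod c M n + (if n is k.+1 then c M * eprod c M k else 0).
Proof.
rewrite eprodS mulrDr mulr1 fpsD mulrC -mulrA fpsXM.
by case: n => // n; rewrite fpsCM.
Qed.

Section Convergence.
Variable c : nat -> R.
Hypotheses (c0 : forall i, 0 <= c i) (c1 : forall i, c i <= i.+1%:R ^- 2).

Lemma eprod_ge0 M n : 0 <= eprod c M n.
Proof.
apply: (@fps_maj_ge0 (eprod c M)); apply: eprod_maj => i.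
by rewrite ger0_norm.
Qed.

Lemma eprod_nd n : {homo (eprod c ^~ n) : M N / (M <= N)%N >-> M <= N}.
Proof.
apply: homo_leq => // [|M]; first exact: le_trans.
rewrite eprod_coefS lerDl; case: n => // n.
by rewrite mulr_ge0 // eprod_ge0.
Qed.

(* The product of the [1 + 1/k^2] for [2 <= k <= M] is at most that of the
   [k^2/(k^2 - 1)], which telescopes. *)
Lemma eprod_le4 M n : eprod c M n <= 4.
Proof.
(* A coefficient of a polynomial with nonnegative coefficients is at most its value at X = 1. *)
suff h : eprod c M n <= \prod_(i < M) (1 + c i).
  apply: (le_trans h).
  case: M {h} => [|M]; first by rewrite big_ord0; lra.
  (* The factor k = 1 is at most 2, and the telescoped bound for 2 <= k <= M+1 is 2 (M+1)/(M+2). *)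
  suff h : \prod_(i < M.+1) (1 + c i) <= 4 * M.+1%:R / M.+2%:R.
    apply: (le_trans h); rewrite ler_pdivrMr ?ltr0n// ler_pM2l // ler_nat.
    exact: leqnSn.
  elim: M => [|M ih].
    rewrite big_ord1; have := c1 0; rewrite expr1n invr1; lra.
  rewrite big_ord_recr /=.
  have h0 : 0 <= \prod_(i < M.+1) (1 + c i).
    by apply: prodr_ge0 => i _; rewrite addr_ge0.
  have h1 : 1 + c M.+1 <= 1 + M.+2%:R ^- 2 by rewrite lerD2l.
  apply: le_trans (ler_pM h0 _ ih h1) _; first by rewrite addr_ge0.
  have m0 : 0 <= (M%:R : R) by [].
  have -> : (M.+1%:R : R) = M%:R + 1 by rewrite -natr1.
  have -> : (M.+2%:R : R) = M%:R + 2 by rewrite -addn2 natrD.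
  have -> : (M.+3%:R : R) = M%:R + 3 by rewrite -addn3 natrD.
  move: (M%:R : R) m0 => x x0.
  have -> : 4 * (x + 1) / (x + 2) * (1 + (x + 2) ^- 2) =
    4 * ((x + 1) * ((x + 2) ^+ 2 + 1) / (x + 2) ^+ 3).
    field; lra.
  rewrite -[leRHS]mulrA ler_pM2l // ler_pdivrMr; last by apply: exprn_gt0; lra.
  rewrite mulrAC ler_pdivlMr; last by lra.
  rewrite -subr_ge0; have -> : (x + 2) * (x + 2) ^+ 3 - (x + 1) *
    ((x + 2) ^+ 2 + 1) * (x + 3) = 1 by ring.
  by [].
elim: M n => [|M ih] n.
  by rewrite /eprod !big_ord0 fps1; case: (n == 0%N).
rewrite eprod_coefS big_ord_recr /= mulrDr mulr1.
apply: lerD => //; rewrite mulrC; case: n => [|n].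
  by apply: mulr_ge0 => //; apply: prodr_ge0 => i _; rewrite addr_ge0.
by rewrite ler_wpM2l.
Qed.

Lemma eprod_cvg : exists l, fps_cvg (eprod c) l.
Proof.
exists (fun n => limn (eprod c ^~ n)) => n.
apply: nondecreasing_is_cvgn; first exact: eprod_nd.
by exists 4 => _ [M _ <-]; exact: eprod_le4.
Qed.

End Convergence.

End FpsLimits.

(** * Limits of the truncated zigzag series *)

Section ZetaThreeOne.
Variable R : realType.
Implicit Types M n : nat.

Definition wt e (k : nat) : R := k%:R ^- e.

Lemma wtM d e : (fun k => wt d k * wt e k) = wt (d + e).
Proof. by apply/funext => k; rewrite /wt exprD invfM. Qed.

Definition inv_natS n : fps R := fpsC (n.+1%:R^-1).

Lemma fpsCM2 (a b : R) : fpsC (a * b) = fpsC a * fpsC b.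
Proof. by apply/funext => -[|n]; rewrite fpsCM //= mulr0. Qed.

Lemma fpsC_exp (a : R) k : fpsC a ^+ k = fpsC (a ^+ k).
Proof.
elim: k => [|k ih]; last by rewrite !exprS ih fpsCM2.
by apply/funext => -[|n].
Qed.

Lemma fpsC_nat k : k%:R = fpsC k%:R :> fps R.
Proof.
elim: k => [|k ih]; first by apply/funext => -[|n].
rewrite -natr1 ih; apply/funext => -[|n]; rewrite fpsD fps1 /=.
  by rewrite natr1.
by rewrite addr0.
Qed.

Lemma inv_natSP n : inv_natS n * n.+1%:R = 1.
Proof.
rewrite fpsC_nat -fpsCM2 mulVf ?pnatr_eq0 //.
by apply/funext => -[|k].
Qed.

(** With u the variable, each pair of a chain contributes - 4 u^2, so the chains of n pairs sit in
    degree 2n with a factor 4^n. *)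
Lemma strict_gf_coef M x n : (x <= M)%N ->
  (strict_gf inv_natS (4%:R * fpsX ^+ 2) x).1 n.*2 =
    4 ^+ n * desc_gf (wt 1) (wt 3) M rel_gt x.+1 n /\
  (strict_gf inv_natS (4%:R * fpsX ^+ 2) x).2 n.*2 =
    4 ^+ n * desc_gf' (wt 1) (wt 3) M rel_gt x.+1 n.
Proof.
elim: x n => [|x ih] n xM.
  have [-> -> _ _] := desc_gf0 (wt 1) (wt 3) M.
  by rewrite /= mulr0 !fps1; case: n => [|n]; rewrite /= ?mulr0 ?mulr1.
have [-> ->] := strict_desc_gfS (wt 1) (wt 3) xM.
have {}ih k := ih k (ltnW xM).
rewrite [strict_gf _ _ _]/= /strict_step.
move: (strict_gf _ _ _) ih => [F G] /= ih.
rewrite !fpsD !fpsN fpsCM (ih n).1 (ih n).2 fpsCM; split; last first.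
  by rewrite (ih n).1 /wt expr1; ring.
have -> : 4%:R * fpsX ^+ 2 * inv_natS x ^+ 3 * G =
    fpsX * (fpsX * (fpsC (4 * wt 3 x.+1) * G)).
  by rewrite /inv_natS fpsC_exp fpsC_nat fpsCM2 /wt exprVn; ring.
rewrite !fpsXM; case: n => [|n].
  by rewrite /= oppr0 !addr0.
by rewrite doubleS /= !fpsXM !fpsCM (ih n).2 exprS; ring.
Qed.

Lemma pow_gf_eprod d e M x : (x <= M)%N ->
  pow_gf (wt d) (wt e) M x = eprod (fun i => wt (d + e) i.+1) x.
Proof.
elim: x => [|x ih] xM; first by rewrite pow_gf0 /eprod big_ord0.
by rewrite pow_gfS // ih ?(ltnW xM)// eprodS mulrC -wtM.
Qed.

Lemma wt_ge0 e k : 0 <= wt e k.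
Proof. by rewrite /wt invr_ge0 exprn_ge0. Qed.

Lemma wt_le2 e i : (2 <= e)%N -> wt e i.+1 <= i.+1%:R ^- 2.
Proof.
move=> e2; rewrite /wt lef_pV2 ?posrE ?exprn_gt0 ?ltr0n //.
by rewrite ler_weXn2l // ler1n.
Qed.

Lemma fps_sum_mul (A : comNzRingType) (f g : fps A) M :
  \sum_(k < M.+1) (f * g) k =
  \sum_(i < M.+1) \sum_(j < M.+1 | (i + j < M.+1)%N) f i * g j.
Proof.
under eq_bigr => k _.
  rewrite fpsM (big_ord_widen M.+1 (fun i => f i * g (k - i)%N)) //.
  over.
rewrite (exchange_big_dep xpredT) //=; apply: eq_bigr => i _.
rewrite -(big_mkord (fun k => i < k.+1)%N (fun k => f i * g (k - i)%N)).
rewrite -(big_mkord (fun j => i + j < M.+1)%N (fun j => f i * g j)).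
have iM := ltn_ord i.
rewrite (@big_cat_nat _ _ _ i) ?(ltnW iM) //=.
rewrite big_nat_cond big1 ?add0r; last first.
  by move=> k; lia.
rewrite -{1}(add0n i) big_addn.
rewrite [RHS](@big_cat_nat _ _ _ (M.+1 - i)) ?leq_subr //=.
rewrite [X in _ = _ + X]big_nat_cond [X in _ = _ + X]big1 ?addr0; last first.
  by move=> k; lia.
rewrite big_nat_cond [RHS]big_nat_cond; apply: eq_big => k; first by lia.
by rewrite addnK.
Qed.

Let c2 (s : R) i := s * wt 2 i.+1.
Let Pm := eprod (fun i => wt 2 i.+1).

Let hypP (s : R) v : v = fpsC s * fpsX -> forall n,
  \sum_(i < n.+1) hyp inv_natS v i = eprod (c2 (- s)) n /\
  hyp inv_natS v n.+1 = fpsX * fpsC (c2 (- s) n) * eprod (c2 (- s)) n.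
Proof.
move=> vE n.
have e i : - (v * inv_natS i ^+ 2) = fpsX * fpsC (c2 (- s) i).
  rewrite vE /inv_natS fpsC_exp /c2 mulNr.
  have -> : fpsC (- (s * wt 2 i.+1)) = - fpsC (s * wt 2 i.+1) :> fps R.
    by apply/funext => -[|k]; rewrite fpsN //= oppr0.
  by rewrite fpsCM2 /wt exprVn; ring.
have [-> ->] := sum_hyp inv_natSP v n; rewrite mulNr e /eprod.
by split; [|congr (_ * _)]; apply: eq_bigr => i _; rewrite e.
Qed.

(** The increments of the partial products of 1 + X/k^2. They majorise the coefficients of both
    hypergeometric series. *)
Let Dm i := if i is k.+1 then Pm k.+1 - Pm k else 1.

Let sum_Dm n : \sum_(i < n.+1) Dm i = Pm n.
Proof.
elim: n => [|n ih]; first by rewrite big_ord1 /Pm /eprod big_ord0.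
by rewrite big_ord_recr ih /=; ring.
Qed.

Let hyp_maj (s : R) v : v = fpsC s * fpsX -> `|s| = 1 ->
  forall i, fps_maj (hyp inv_natS v i) (Dm i).
Proof.
move=> vE s1 [|n]; first exact: fps_maj1.
have cm i : `|c2 (- s) i| <= wt 2 i.+1.
  by rewrite /c2 normrM normrN s1 mul1r ger0_norm // wt_ge0.
rewrite (hypP vE n).2 /Dm /Pm eprodS mulrDr mulr1 addrC addKr mulrC.
by apply: fps_majM; [exact: eprod_maj|exact: fps_majX].
Qed.

(** The product of partial sums runs over the square i, j <= M, the partial sum of the Cauchy
    product over the triangle i + j <= M. A term in one but not the other has i > M/2 or j > M/2, so
    majorants outside the square of side M/2 bound the difference. *)
Lemma strict_gf_eprod M : fps_maj
  (eprod (c2 (-1)) M * eprod (c2 1) M -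
    (strict_gf inv_natS (4%:R * fpsX ^+ 2) M).1)
  (Pm M * Pm M - Pm M./2 * Pm M./2).
Proof.
have E1 : fpsX = fpsC 1 * fpsX :> fps R.
  by apply/funext => n; rewrite fpsCM mul1r.
have E2 : - fpsX = fpsC (-1) * fpsX :> fps R.
  apply/funext => n; rewrite fpsCM mulN1r //.
rewrite (strict_gf_hyp inv_natSP) fps_sum_mul.
rewrite -(hypP E1 M).1 -[X in c2 X](opprK 1) -(hypP E2 M).1 big_distrlr /=.
rewrite -sumrB.
have sumE (F : nat -> nat -> fps R) (P : nat -> nat -> bool) :
  \sum_(i < M.+1) ((\sum_(j < M.+1) F i j) - \sum_(j < M.+1 | P i j) F i j) =
  \sum_(i < M.+1) \sum_(j < M.+1 | ~~ P i j) F i j.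
  apply: eq_bigr => i _; rewrite (bigID (fun j : 'I__ => P i j)) /=.
  by rewrite addrAC subrr add0r.
rewrite (sumE (fun i j => hyp inv_natS fpsX i * hyp inv_natS (- fpsX) j)
  (fun i j => i + j < M.+1)%N).
have hE : Pm M./2 * Pm M./2 = \sum_(i < M.+1) \sum_(j < M.+1 |
    (i <= M./2)%N && (j <= M./2)%N) Dm i * Dm j.
  have h1 : Pm M./2 = \sum_(i < M.+1 | (i <= M./2)%N) Dm i.
    rewrite -sum_Dm (big_ord_widen M.+1 Dm) //; lia.
  rewrite {2}h1 {1}h1 big_distrlr /= [LHS]big_mkcond; apply: eq_bigr => i _.
  by case: ifP => // _; rewrite big_pred0.
rewrite hE -(sum_Dm M) big_distrlr -sumrB /=.
rewrite (sumE (fun i j => Dm i * Dm j)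
  (fun i j => (i <= M./2) && (j <= M./2))%N).
have Dm0 i n : 0 <= Dm i n.
  by apply: fps_maj_ge0; apply: (hyp_maj E1); rewrite normr1.
have DD0 i j n : 0 <= (Dm i * Dm j) n.
  by rewrite fpsM sumr_ge0 // => k _; rewrite mulr_ge0.
apply: fps_maj_sum => i _.
(* The majorant also has terms inside the triangle but outside the small square; being nonnegative,
   they may be dropped. *)
rewrite [X in fps_maj _ X](bigID (fun j : 'I_M.+1 => i + j < M.+1)%N) /= addrC.
rewrite [X in fps_maj _ (X + _)](eq_bigl
  (fun j : 'I_M.+1 => ~~ (i + j < M.+1)%N)); last by move=> j /=; lia.
apply: fps_majDr; last first.
  move=> n; elim/big_ind: _ => // f g f0 g0; rewrite fpsD; exact: addr_ge0.
apply: fps_maj_sum => j _; apply: fps_majM.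
  by apply: (hyp_maj E1); rewrite normr1.
by apply: (hyp_maj E2); rewrite normrN1.
Qed.

(** Factor by factor, (1 - X/k^2)(1 + X/k^2) = 1 - X^2/k^4. *)
Let eprod_diff_squares M n : (eprod (c2 (-1)) M * eprod (c2 1) M) n.*2 =
  (-1) ^+ n * eprod (fun i => wt 4 i.+1) M n.
Proof.
elim: M n => [|M ih] n.
  by rewrite /eprod !big_ord0 mulr1 !fps1; case: n => [|n];
    rewrite /= ?mulr0 ?mulr1.
rewrite eprod_coefS !eprodS.
have -> : eprod (c2 (-1)) M * (1 + fpsX * fpsC (c2 (-1) M)) *
    (eprod (c2 1) M * (1 + fpsX * fpsC (c2 1 M))) =
  eprod (c2 (-1)) M * eprod (c2 1) M - fpsX * (fpsX * (fpsC (wt 4 M.+1) *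
    (eprod (c2 (-1)) M * eprod (c2 1) M))).
  have -> : fpsC (c2 (-1) M) = - fpsC (wt 2 M.+1).
    by apply/funext => -[|k]; rewrite fpsN /= ?oppr0 // /c2 mulN1r.
  have -> : fpsC (c2 1 M) = fpsC (wt 2 M.+1) by rewrite /c2 mul1r.
  rewrite -(wtM 2 2) fpsCM2; ring.
rewrite fpsD fpsN !fpsXM ih; case: n => [|n]; first by rewrite /= oppr0 !addr0.
by rewrite doubleS /= fpsXM fpsCM ih exprS; ring.
Qed.

Let cvg_half : M./2 @[M --> \oo] --> \oo.
Proof.
by apply/cvgnyPge => N; exists N.*2 => // M /= NM; lia.
Qed.

(** [Pm] converges, so the majorant of [strict_gf_eprod] tends to 0 and the Cauchy product has the
    same limit as the partial products of 1 - X^2/k^4. *)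
Lemma desc_gf_cvg (E : fps R) : fps_cvg (eprod (fun i => wt 4 i.+1)) E ->
  fps_cvg (fun M => desc_gf (wt 1) (wt 3) M rel_gt M.+1)
    (fun n => 4 ^- n * ((-1) ^+ n * E n)).
Proof.
move=> Ec n.
have [L PL] : exists L, fps_cvg Pm L.
  by apply: eprod_cvg => i; [exact: wt_ge0|exact: wt_le2].
have PL' : fps_cvg (fun M => Pm M./2) L.
  by move=> k; apply: (cvg_comp _ (fun M => Pm M k) cvg_half); exact: PL.
have := fps_cvgD (fps_cvgM PL PL) (fps_cvgN (fps_cvgM PL' PL')).
rewrite subrr => /(_ n.*2) D0.
pose f M := (strict_gf inv_natS (4%:R * fpsX ^+ 2) M).1.
have fE : f M n.*2 @[M --> \oo] --> (-1) ^+ n * E n.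
  rewrite -[X in _ --> X]subr0.
  have -> : (fun M => f M n.*2) = (fun M =>
      (-1) ^+ n * eprod (fun i => wt 4 i.+1) M n -
      (eprod (c2 (-1)) M * eprod (c2 1) M - f M) n.*2).
    apply/funext => M; rewrite fpsD fpsN eprod_diff_squares; ring.
  apply: cvgB; first by apply: cvgMr; exact: Ec.
  apply: norm_cvg0; apply: squeeze_cvgr (cvg_cst _) D0.
  by near=> M; rewrite normr_ge0 /=; exact: strict_gf_eprod.
have -> : (fun M => desc_gf (wt 1) (wt 3) M rel_gt M.+1 n) =
    (fun M => 4 ^- n * f M n.*2).
  by apply/funext => M; rewrite /f (strict_gf_coef n (leqnn M)).1 mulKf.
by apply: cvgMr.
Unshelve. all: by end_near.
Qed.

(** [E] and [H] will be the generating series of zeta({4}^n) and zeta*({4}^n). Only products are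
    shown to converge directly; the weak and zigzag limits come from inversion and
    multiplication. *)
Lemma zigzag_gf_cvg : exists E H : fps R,
  [/\ fps_cvg (zigzag_gf (wt 4) [::] rel_gt) E,
      fps_cvg (zigzag_gf (wt 4) [::] rel_le) H,
      fps_cvg (zigzag_gf (wt 3) [:: (rel_gt, wt 1)] rel_le)
        (fun n => 4 ^- n * H n) &
      fps_cvg (zigzag_gf (wt 3) [:: (rel_ge, wt 1)] rel_lt)
        (((fun n => 4 ^- n * H n) : fps R) * E)].
Proof.
have [E Ec] : exists E, fps_cvg (eprod (fun i => wt 4 i.+1)) E.
  by apply: eprod_cvg => i; [exact: wt_ge0|exact: wt_le2].
have eE M : zigzag_gf (wt 4) [::] rel_gt M = eprod (fun i => wt 4 i.+1) M.
  by rewrite -(pow_gf_eprod 1 3 (leqnn M)) -zigzag_gf_pow wtM.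
have {}Ez : fps_cvg (zigzag_gf (wt 4) [::] rel_gt) E.
  by move=> n; under eq_cvg do rewrite eE; exact: Ec.
have ENz : fps_cvg (zigzag_gfN (wt 4) [::] rel_gt) (fun n => (-1) ^+ n * E n).
  by move=> n; apply: cvgMr; exact: Ez.
have gtP x y : rel_gt x y = ~~ rel_le x y by exact: ltnNge.
have N0 (w : nat -> R) t r M : zigzag_gfN w t r M 0%N = 1.
  by rewrite /zigzag_gfN mulr1.
have [H Hz HE] := fps_cvg_inv (N0 _ _ _) (fun M => zigzag_compl _ _ M gtP) ENz.
pose E4 : fps R := fun n => 4 ^- n * ((-1) ^+ n * E n).
pose H4 : fps R := fun n => 4 ^- n * H n.
have Fc : fps_cvg (zigzag_gfN (wt 3) [:: (rel_gt, wt 1)] rel_gt) E4.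
  move=> n; under eq_cvg do rewrite zigzag_gfN_gt.
  exact: desc_gf_cvg.
have [S Sz SE] := fps_cvg_inv (N0 _ _ _) (fun M => zigzag_compl _ _ M gtP) Fc.
(* This is [HE] with X/4 substituted for X. Uniqueness of inverses then identifies [S] with [H4]. *)
have HE4 : E4 * H4 = 1.
  rewrite mulrC; apply/funext => n.
  have := congr1 (fun f : fps R => 4 ^- n * f n) HE.
  rewrite fpsM fps1 => h.
  transitivity (4 ^- n * (n == 0%N)%:R : R); last first.
    by case: n {h} => [|n]; rewrite /= ?mulr0 // expr0 invr1 mulr1.
  rewrite -h mulr_sumr fpsM; apply: eq_bigr => i _; rewrite /H4 /E4.
  have -> : 4 ^- n = 4 ^- i * 4 ^- (n - i) :> R.
    by rewrite -invfM -exprD subnKC ?leq_ord.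
  by ring.
have SH : S = H4 by rewrite -[LHS]mulr1 -HE4 mulrA SE mul1r.
exists E, H; split=> //; first by rewrite -/H4 -SH.
rewrite -/H4 -SH => n.
have -> : (fun M => zigzag_gf (wt 3) [:: (rel_ge, wt 1)] rel_lt M n) =
  (fun M => (zigzag_gf (wt 3) [:: (rel_gt, wt 1)] rel_le M *
   zigzag_gf (wt 4) [::] rel_gt M) n).
  by apply/funext => M; rewrite zigzag_gf_star wtM.
exact: (@fps_cvgM _ _ _ _ _ Sz Ez n).
Qed.

End ZetaThreeOne.

(** * Unconditional sums over chains *)

Section ChainEsum.
Variable R : realType.
Local Notation links := (seq (rel nat * (nat -> R))).
Implicit Types (s : links) (m : seq nat) (x M : nat).

Fixpoint chain s x m : bool :=
  match s, m with
  | [::], [::] => true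
  | (r, _) :: s', y :: m' => [&& 1 <= y, r x y & chain s' y m']%N
  | _, _ => false
  end.

Fixpoint chain_weight s m : R :=
  match s, m with
  | (_, w) :: s', y :: m' => w y * chain_weight s' m'
  | _, _ => 1
  end.

Fixpoint chains M s x : seq (seq nat) :=
  if s is (r, _) :: s' then
    [seq y :: m | y <- [seq y <- iota 1 M | r x y], m <- chains M s' y]
  else [:: [::]].

Lemma mem_chains M s x m :
  (m \in chains M s x) = chain s x m && all (fun y => y <= M)%N m.
Proof.
elim: s x m => [|[r w] s ih] x m /=; first by rewrite inE; case: m.
apply/allpairsPdep/idP => [[y [m' [yM m'M ->]]]|].
  move: yM m'M; rewrite mem_filter mem_iota ih => /= /andP[-> yM] /andP[-> ->].
  lia.
case: m => // y m /= /andP[/and3P[y1 rxy cm] /andP[yM mM]].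
exists y, m; rewrite mem_filter mem_iota ih rxy cm mM; split=> //=; lia.
Qed.

Lemma chains_uniq M s x : uniq (chains M s x).
Proof.
elim: s x => [|[r w] s ih] x //=.
apply: allpairs_uniq_dep => [|y _|]; first by rewrite filter_uniq // iota_uniq.
  exact: ih.
by move=> [y1 m1] [y2 m2] _ _ /= [-> ->].
Qed.

Lemma sum_chains M s x :
  \sum_(m <- chains M s x) chain_weight s m = csum M s x.
Proof.
elim: s x => [|[r w] s ih] x /=; first by rewrite big_seq1.
rewrite big_allpairs_dep big_filter /index_iota subSS subn0.
by apply: eq_bigr => y _; rewrite -mulr_sumr ih.
Qed.

Lemma chain_size s x m : chain s x m -> size m = size s.
Proof.
by elim: s x m => [|[r w] s ih] x [|y m] //= /and3P[_ _ /ih ->].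
Qed.

Section Nonnegative.
Variable s : links.
Hypothesis s0 : forall i y, 0 <= (nth (rel_any, fun=> 1) s i).2 y.

Lemma chain_weight_ge0 m : 0 <= chain_weight s m.
Proof.
elim: s s0 m => [|[r w] t ih] t0 [|y m] //=.
by apply: mulr_ge0; [exact: (t0 0%N)|apply: ih => i; exact: (t0 i.+1)].
Qed.

(** The finite sets [chains M s x] increase and exhaust all chains; with nonnegative weights, the
    supremum over finite subsets is the limit over [M]. *)
Lemma esum_chain (x : nat) (l : R) : csum M s x @[M --> \oo] --> l ->
  \esum_(m in [set m | chain s x m]) (chain_weight s m)%:E = l%:E.
Proof.
move=> sl.
have csumE M : (csum M s x)%:E =
    (\sum_(m \in [set` chains M s x]) (chain_weight s m)%:E)%R.
  by rewrite -fsbig_seq ?chains_uniq // sumEFin sum_chains.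
have fin (A B : set (seq nat)) : finite_set A -> finite_set B -> A `<=` B ->
  ((\sum_(m \in A) (chain_weight s m)%:E)%R <=
   (\sum_(m \in B) (chain_weight s m)%:E)%R)%E.
  move=> fA fB AB; apply: lee_fsum_nneg_subset => //.
    by move=> m; rewrite !inE; exact: AB.
  by move=> m _; rewrite lee_fin chain_weight_ge0.
have nd : {homo (fun M => csum M s x) : M N / (M <= N)%N >-> M <= N}.
  move=> M N MN; rewrite -lee_fin !csumE; apply: fin => //.
  move=> m; rewrite /= !mem_chains => /andP[-> /allP mM] /=.
  by apply/allP => y /mM /= yM; exact: leq_trans yM MN.
apply/eqP; rewrite eq_le; apply/andP; split.
  apply: ge_ereal_sup => _ [A [fA AS] <-].
  have [M AM] : exists M, A `<=` [set` chains M s x].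
    have /finite_seqP[r Ar] := fA.
    (* The largest entry occurring in [A] is a truncation that contains all of [A]. *)
    exists (\max_(m <- r) \max_(y <- m) y)%N => m Am.
    rewrite /= mem_chains (AS _ Am); apply/allP => y ym.
    have mr : m \in r by move: Am; rewrite Ar.
    by apply: leq_trans (@leq_bigmax_seq _ r xpredT (fun m => \max_(y <- m) y)%N
      m mr isT); exact: (@leq_bigmax_seq _ m xpredT id).
  apply: le_trans (fin _ _ fA (finite_seq _) AM) _.
  rewrite -csumE lee_fin -(cvg_lim _ sl) //.
  exact: (nondecreasing_cvgn_le nd (cvgP _ sl)).
have sl' : (csum M s x)%:E @[M --> \oo] --> l%:E.
  by apply: cvg_EFin => //; near=> M.
rewrite -(cvg_lim _ sl') //; apply: lime_le.
  exact: cvgP sl'.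
near=> M; rewrite csumE; apply: ereal_sup_ubound.
exists [set` chains M s x] => //; split; first exact: finite_seq.
by move=> m; rewrite /= mem_chains => /andP[].
Unshelve. all: by end_near.
Qed.

End Nonnegative.

End ChainEsum.

(** * Zeta values of repeated 4 as sums over chains *)

Section ChainNth.
Variable R : realType.
Local Notation links := (seq (rel nat * (nat -> R))).
Implicit Types (s : links) (m : seq nat) (x M : nat) (f : nat -> nat).
Local Notation link0 := (rel_any, (fun=> 1) : nat -> R).

Lemma mkseqS T (f : nat -> T) n : mkseq f n.+1 = f 0%N :: mkseq (f \o S) n.
Proof. by rewrite /mkseq /= (iotaDl 1 0 n) -map_comp. Qed.

Lemma chain_mkseq s x f : reflect
  (forall t, (t < size s)%N -> (0 < f t)%N /\
    (nth link0 s t).1 (if t is u.+1 then f u else x) (f t))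
  (chain s x (mkseq f (size s))).
Proof.
elim: s x f => [|[r w] s ih] x f; first by rewrite /=; constructor.
rewrite [size _]/= mkseqS /=; apply: (iffP and3P).
  move=> [f0 rf /ih h] [|t] //=; rewrite ltnS => /h [ft rt]; split=> //.
  by case: t {ft} rt.
move=> h; have [f0 rf] := h 0%N isT; split=> //.
by apply/ih => t /(h t.+1); case: t.
Qed.

Lemma chain_weight_mkseq s f : chain_weight s (mkseq f (size s)) =
  \prod_(t < size s) (nth link0 s t).2 (f t).
Proof.
elim: s f => [|[r w] s ih] f; first by rewrite big_ord0.
by rewrite [size _]/= mkseqS big_ord_recl /= ih.
Qed.

Lemma chain_zigzag1 (w0 : nat -> R) r n m : chain (zigzag w0 [::] r n) 0 m =
  [&& size m == n, all (leq 1) m & sorted r m].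
Proof.
have pathE k x m' : chain (iter k (cat [:: (r, w0)]) [::]) x m' =
    [&& size m' == k, all (leq 1) m' & path r x m'].
  elim: k x m' => [|k ih] x [|y m'] //=; rewrite ih eqSS.
  by case: (1 <= y)%N; case: (r x y); rewrite ?andbF.
case: n m => [|n] [|y m] //=; rewrite pathE eqSS.
by case: (1 <= y)%N; rewrite ?andbF.
Qed.

Lemma weight_zigzag1 (w0 : nat -> R) r n m : size m = n ->
  chain_weight (zigzag w0 [::] r n) m = \prod_(y <- m) w0 y.
Proof.
have E k m' : size m' = k ->
    chain_weight (iter k (cat [:: (r, w0)]) [::]) m' = \prod_(y <- m') w0 y.
  by move=> <-; elim: m' => [|y m' ih]; rewrite ?big_nil ?big_cons //= ih.
case: n m => [|n] [|y m] //=; rewrite ?big_nil ?big_cons //.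
by move=> [/E ->].
Qed.

Lemma size_zigzag2 (w0 w1 : nat -> R) r r1 n :
  size (zigzag w0 [:: (r1, w1)] r n) = n.*2.
Proof. by case: n => //= n; congr S; elim: n => //= n [->]. Qed.

Lemma nth_zigzag2 (w0 w1 : nat -> R) r r1 n t : (t < n.*2)%N ->
  nth link0 (zigzag w0 [:: (r1, w1)] r n) t =
  if odd t then (r1, w1) else (if t == 0%N then rel_any else r, w0).
Proof.
case: n => //= n; case: t => [|[|t]] //=; rewrite negbK !ltnS.
elim: n t => //= n ih [|[|t]] //=; rewrite !ltnS negbK; exact: ih.
Qed.

Lemma zigzag1_weight_ge0 (w0 : nat -> R) r n i y : (forall z, 0 <= w0 z) ->
  0 <= (nth link0 (zigzag w0 [::] r n) i).2 y.
Proof.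
move=> w0_ge0; case: n => [|n]; first by rewrite nth_default.
case: i => [|i] //=; elim: n i => [|n ih] [|i] //=; exact: ih.
Qed.

Lemma size_tuple_nseq n (e : nat) (m : (size (nseq n e)).-tuple nat) :
  size m = n.
Proof. by rewrite (size_tuple m) size_nseq. Qed.

Lemma mzterm_nseq n e (m : (size (nseq n e)).-tuple nat) :
  mzterm R m = \prod_(y <- m) wt R e y.
Proof.
rewrite /mzterm big_tuple; apply: eq_bigr => i _.
by rewrite nth_nseq -[X in (_ < X)%N](size_nseq n e) ltn_ord.
Qed.

Lemma mzeta_starE n (l : R) :
  zigzag_gf (wt R 4) [::] rel_le M n @[M --> \oo] --> l ->
  mzeta_star R (nseq n 4%N) = l%:E.
Proof.
move=> /esum_chain <-; last first.
  by move=> i y; apply: zigzag1_weight_ge0; exact: wt_ge0.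
rewrite [RHS](reindex_esum [set m : (size (nseq n 4%N)).-tuple nat |
  all (leq 1) m /\ sorted leq m] _ (@tval _ nat)).
  apply: eq_esum => m _; congr EFin.
  by rewrite mzterm_nseq weight_zigzag1 // size_tuple_nseq.
split.
- move=> m /= [m1 ms]; rewrite chain_zigzag1 m1 size_tuple_nseq eqxx.
  exact: ms.
- by move=> m m' _ _ /val_inj.
- move=> m /=; rewrite chain_zigzag1 => /and3P[/eqP mn m1 ms].
  have mk : size m == size (nseq n 4%N) by rewrite size_nseq mn.
  by exists (Tuple mk).
Qed.

(** [rel_gt] reads a tuple from its largest entry down, hence the reversal; the weight is unchanged
    because all exponents are equal. *)
Lemma mzetaE n (l : R) :
  zigzag_gf (wt R 4) [::] rel_gt M n @[M --> \oo] --> l ->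
  mzeta R (nseq n 4%N) = l%:E.
Proof.
move=> /esum_chain <-; last first.
  by move=> i y; apply: zigzag1_weight_ge0; exact: wt_ge0.
rewrite [RHS](reindex_esum [set m : (size (nseq n 4%N)).-tuple nat |
  all (leq 1) m /\ sorted ltn m] _
  (fun m : (size (nseq n 4%N)).-tuple nat => rev m)).
  apply: eq_esum => m _; congr EFin.
  rewrite mzterm_nseq weight_zigzag1 ?size_rev ?size_tuple_nseq //.
  by apply: perm_big; rewrite perm_sym perm_rev.
split.
- move=> m /= [m1 ms]; rewrite chain_zigzag1 size_rev size_tuple_nseq eqxx.
  by rewrite all_rev m1 rev_sorted.
- by move=> m m' _ _ /(congr1 rev); rewrite !revK => /val_inj.
- move=> m /=; rewrite chain_zigzag1 => /and3P[/eqP mn m1 ms].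
  have mk : size (rev m) == size (nseq n 4%N) by rewrite size_rev size_nseq mn.
  exists (Tuple mk); last by rewrite /= revK.
  by rewrite /= all_rev m1 rev_sorted.
Qed.

End ChainNth.

(** * Ribbon diagrams read as zigzags *)

Section Ribbons.
Variable R : realType.
Local Notation link0 := (rel_any, (fun=> 1) : nat -> R).

Section Ribbon.
Variables (lam mu : seq nat) (s : seq (rel nat * (nat -> R))).
(** [cel] walks along the ribbon cell by cell, and [pos] is its inverse on the diagram. *)
Variables (cel : nat -> nat * nat) (pos : nat * nat -> nat).
Hypothesis cel_in : forall t, (t < size s)%N -> cel t \in cells lam mu.
Hypothesis celK : forall t, (t < size s)%N -> pos (cel t) = t.
Hypothesis pos_lt : forall c, c \in cells lam mu -> (pos c < size s)%N.
Hypothesis posK : forall c, c \in cells lam mu -> cel (pos c) = c.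
Implicit Types m k : filling lam mu.

(** The default 0 is never reached for [t < size s], where [cel t] is a cell. *)
Definition entry m t : nat := oapp m 0%N (insub (cel t)).

Lemma entry_pos m (c : diagram lam mu) : entry m (pos (ssval c)) = m c.
Proof. by rewrite /entry posK ?ssvalP// valK. Qed.

(** Reading a filling along the walk is a bijection from semistandard fillings to chains that
    preserves the weight. *)
Lemma esum_ribbon k (l : R) :
  (forall m, semistandard m <-> chain s 0 (mkseq (entry m) (size s))) ->
  (forall c : diagram lam mu, (nth link0 s (pos (ssval c))).2 = wt R (k c)) ->
  csum M s 0 @[M --> \oo] --> l -> schur_zeta R k = l%:E.
Proof.
move=> ssP wP sl.
have s0 i y : 0 <= (nth link0 s i).2 y.
  case: (ltnP i (size s)) => hi; last by rewrite nth_default.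
  by have := wP (SeqSub (cel_in hi)); rewrite /= celK // => ->; exact: wt_ge0.
rewrite -(esum_chain s0 sl) /schur_zeta.
rewrite [RHS](reindex_esum [set m : filling lam mu | semistandard m] _
  (fun m : filling lam mu => mkseq (entry m) (size s))).
  apply: eq_esum => m _; congr EFin; rewrite chain_weight_mkseq.
  pose h (t : 'I_(size s)) : diagram lam mu := SeqSub (cel_in (ltn_ord t)).
  pose g (c : diagram lam mu) : 'I_(size s) := Ordinal (pos_lt (ssvalP c)).
  have hK : cancel h g by move=> t; apply: val_inj; rewrite /= celK.
  have gK : cancel g h by move=> c; apply: val_inj; rewrite /= posK // ssvalP.
  rewrite (reindex h); last by apply: onW_bij; exists g.
  apply: eq_bigr => t _.
  by rewrite -(entry_pos m (h t)) -[_ ^- _]/(wt R (k (h t)) _) -wP /= celK.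
split.
- by move=> m /ssP.
- move=> m m' _ _ e; apply/ffunP => c; rewrite -!entry_pos.
  have := congr1 (nth 0%N ^~ (pos (ssval c))) e.
  by rewrite /= !nth_mkseq // pos_lt // ssvalP.
- move=> v /= cv.
  pose m : filling lam mu := [ffun c => nth 0%N v (pos (ssval c))].
  have mv : mkseq (entry m) (size s) = v.
    rewrite -(chain_size cv) -[RHS](mkseq_nth 0%N); apply/eq_in_map => t.
    rewrite mem_iota /= add0n (chain_size cv) => ts.
    by rewrite /entry insubT ?cel_in // => ct; rewrite /= ffunE /= celK.
  by exists m => //; apply/ssP; rewrite mv.
Qed.

Lemma semistandard_ribbon m r r1 w0 w1 n :
  s = zigzag w0 [:: (r1, w1)] r n ->
  (forall c d : diagram lam mu, pos (ssval d) = (pos (ssval c)).+1 ->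
     (if odd (pos (ssval d)) then r1 else r) (m c) (m d)) ->
  (forall c, 0 < m c)%N ->
  chain s 0 (mkseq (entry m) (size s)).
Proof.
move=> sE h m0; apply/chain_mkseq => t ts.
have e u (us : (u < size s)%N) : entry m u = m (SeqSub (cel_in us)).
  by rewrite -entry_pos /= celK.
rewrite (e t ts); split=> //.
rewrite [in nth _ _ _]sE nth_zigzag2 -?(size_zigzag2 w0 w1 r r1 n) -?sE //.
case: t ts => [|t] ts; first by []. have ts' := ltnW ts.
rewrite (e t ts').
have := h (SeqSub (cel_in ts')) (SeqSub (cel_in ts)).
by rewrite /= !celK //= => /(_ erefl); case: (~~ odd t).
Qed.

Lemma chain_ribbon m r r1 w0 w1 n :
  s = zigzag w0 [:: (r1, w1)] r n ->
  chain s 0 (mkseq (entry m) (size s)) ->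
  (forall c, 0 < m c)%N /\
  (forall c d : diagram lam mu, pos (ssval d) = (pos (ssval c)).+1 ->
     (if odd (pos (ssval d)) then r1 else r) (m c) (m d)).
Proof.
move=> sE /chain_mkseq h; split=> [c|c d dc].
  by rewrite -entry_pos; have [] := h _ (pos_lt (ssvalP c)).
rewrite -!entry_pos; have [_] := h _ (pos_lt (ssvalP d)).
rewrite [in nth _ _ _]sE nth_zigzag2; last first.
  by rewrite -(size_zigzag2 w0 w1 r r1) -sE pos_lt // ssvalP.
by rewrite dc /=; case: (~~ odd _).
Qed.

End Ribbon.

(** As a and b differ, a single corner settles which parity class carries b. *)
Lemma checkerboardE lam mu a b (c d : diagram lam mu) :
  checkerboardable a b lam mu -> a != b -> is_corner d ->
  checkerboard a b lam mu c =
    if odd (cell_row c + cell_col c) == odd (cell_row d + cell_col d)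
    then b else a.
Proof.
move=> /checkerboardP[[p kp] kc] ab /kc; rewrite !kp.
case: (odd (cell_row d + cell_col d) == p) / eqP => [<- //|_ /eqP].
by rewrite (negbTE ab).
Qed.

Lemma S13E n (l : R) : (0 < n)%N ->
  zigzag_gf (wt R 3) [:: (rel_gt, wt R 1)] rel_le M n @[M --> \oo] --> l ->
  S13 R n = l%:E.
Proof.
move=> n0 sl; pose s := zigzag (wt R 3) [:: (rel_gt, wt R 1)] rel_le n.
(* The walk starts at the bottom left corner (n+1, 1) and goes alternately up and right. Corners are
   the even positions. *)
pose cel t := (n.+1 - uphalf t, t./2.+1)%N.
pose pos (c : nat * nat) := (n + c.2 - c.1)%N.
have szs : size s = n.*2 by rewrite size_zigzag2.
have memP i j : ((i, j) \in cells (S_outer n) (delta n.-1)) =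
    [&& 0 < i, 0 < j <= n & (i + j == n.+1) || (i + j == n.+2)]%N.
  rewrite mem_cells /S_outer /= size_rev size_iota !nth_delta.
  case: i => [|[|i]] //=; rewrite ?nth_delta; lia.
have H1 t : (t < size s)%N -> cel t \in cells (S_outer n) (delta n.-1).
  by rewrite szs /cel memP; lia.
have H2 t : (t < size s)%N -> pos (cel t) = t by rewrite szs /cel /pos /=; lia.
have H3 c : c \in cells (S_outer n) (delta n.-1) -> (pos c < size s)%N.
  by case: c => i j; rewrite memP szs /pos /=; lia.
have H4 c : c \in cells (S_outer n) (delta n.-1) -> cel (pos c) = c.
  by case: c => i j; rewrite memP /pos /cel /= => h; congr (_, _); lia.
apply: (esum_ribbon H1 H2 H3 H4 _ _ sl).
- move=> m; split.
    move=> [m0 mr mc]; apply: (semistandard_ribbon H1 H2 H4 (erefl s)) => //.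
    move=> c d; case: c d => [[i j] hc] [[i' j'] hd]; rewrite /pos /=.
    have hc' := hc; have hd' := hd; rewrite memP in hc'; rewrite memP in hd'.
    move=> e.
    (* An odd position is reached by a step up a column, an even one by a step along a row. *)
    case: ifP => o.
      apply: mc; rewrite /cell_col /cell_row /=; lia.
    apply: mr; rewrite /cell_col /cell_row /=; lia.
  (* Rows and columns have at most two cells, so every required comparison is between consecutive
     positions. *)
  move=> /(chain_ribbon H3 H4 (erefl s)) [m0 h]; split=> // c d.
    move: (h c d); case: c d => [[i j] hc] [[i' j'] hd].
    rewrite /cell_row /cell_col /pos /=.
    have hc' := hc; have hd' := hd; rewrite memP in hc'; rewrite memP in hd'.
  move=> {}h e1 e2.
    by move: h; rewrite ifF; last lia; apply; lia.
  move: (h d c); case: c d => [[i j] hc] [[i' j'] hd].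
  rewrite /cell_row /cell_col /pos /=.
  have hc' := hc; have hd' := hd; rewrite memP in hc'; rewrite memP in hd'.
  move=> {}h e1 e2.
  by move: h; rewrite ifT; last lia; apply; lia.
- move=> c.
  have hd : (n.+1, 1%N) \in cells (S_outer n) (delta n.-1).
    by rewrite memP; lia.
  have corner : is_corner (SeqSub hd).
    by rewrite /is_corner /cell_row /cell_col /= !memP; lia.
  rewrite (checkerboardE c (checkerboardable_S 1 3 n0) isT corner).
  case: c => [[i j] hc]; rewrite /cell_row /cell_col /=.
  rewrite nth_zigzag2; last by rewrite -szs H3.
  have hc' := hc; rewrite memP in hc'; rewrite /pos /=.
  by case: ifP => o /=; [rewrite ifF //|rewrite ifT //]; lia.
Qed.

Lemma S13_starE n (l : R) : (0 < n)%N ->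
  zigzag_gf (wt R 3) [:: (rel_ge, wt R 1)] rel_lt M n @[M --> \oo] --> l ->
  S13_star R n = l%:E.
Proof.
move=> n0 sl; pose s := zigzag (wt R 3) [:: (rel_ge, wt R 1)] rel_lt n.
(* This walk starts at the top right corner (1, n+1) and goes alternately left and down, so rows
   give the links inside blocks and columns those between them. *)
pose cel t := (t./2.+1, n.+1 - uphalf t)%N.
pose pos (c : nat * nat) := (n + c.1 - c.2)%N.
have szs : size s = n.*2 by rewrite size_zigzag2.
have memP i j : ((i, j) \in cells (Sstar_outer n) (delta n.-1)) =
    [&& 0 < i <= n, 0 < j & (i + j == n.+1) || (i + j == n.+2)]%N.
  rewrite mem_cells /= size_rev size_iota !nth_delta nth_Sstar_outer.
  by case: ifP; lia.
have H1 t : (t < size s)%N -> cel t \in cells (Sstar_outer n) (delta n.-1).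
  by rewrite szs /cel memP; lia.
have H2 t : (t < size s)%N -> pos (cel t) = t by rewrite szs /cel /pos /=; lia.
have H3 c : c \in cells (Sstar_outer n) (delta n.-1) -> (pos c < size s)%N.
  by case: c => i j; rewrite memP szs /pos /=; lia.
have H4 c : c \in cells (Sstar_outer n) (delta n.-1) -> cel (pos c) = c.
  by case: c => i j; rewrite memP /pos /cel /= => h; congr (_, _); lia.
apply: (esum_ribbon H1 H2 H3 H4 _ _ sl).
- move=> m; split.
    move=> [m0 mr mc]; apply: (semistandard_ribbon H1 H2 H4 (erefl s)) => //.
    move=> c d; case: c d => [[i j] hc] [[i' j'] hd]; rewrite /pos /=.
    have hc' := hc; have hd' := hd; rewrite memP in hc'; rewrite memP in hd'.
    move=> e.
    case: ifP => o.
      apply: mr; rewrite /cell_col /cell_row /=; lia.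
    apply: mc; rewrite /cell_col /cell_row /=; lia.
  move=> /(chain_ribbon H3 H4 (erefl s)) [m0 h]; split=> // c d.
    move: (h d c); case: c d => [[i j] hc] [[i' j'] hd].
    rewrite /cell_row /cell_col /pos /=.
    have hc' := hc; have hd' := hd; rewrite memP in hc'; rewrite memP in hd'.
  move=> {}h e1 e2.
    by move: h; rewrite ifT; last lia; apply; lia.
  move: (h c d); case: c d => [[i j] hc] [[i' j'] hd].
  rewrite /cell_row /cell_col /pos /=.
  have hc' := hc; have hd' := hd; rewrite memP in hc'; rewrite memP in hd'.
  move=> {}h e1 e2.
  by move: h; rewrite ifF; last lia; apply; lia.
- move=> c.
  have hd : (1%N, n.+1) \in cells (Sstar_outer n) (delta n.-1).
    by rewrite memP; lia.
  have corner : is_corner (SeqSub hd).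
    by rewrite /is_corner /cell_row /cell_col /= !memP; lia.
  rewrite (checkerboardE c (checkerboardable_Sstar 1 3 n0) isT corner).
  case: c => [[i j] hc]; rewrite /cell_row /cell_col /=.
  rewrite nth_zigzag2; last by rewrite -szs H3.
  have hc' := hc; rewrite memP in hc'; rewrite /pos /=.
  by case: ifP => o /=; [rewrite ifF //|rewrite ifT //]; lia.
Qed.

End Ribbons.

(** * The two evaluations *)

Local Open Scope ereal_scope.

Theorem theorem3p4 (R : realType) (n : nat) (hn : (1 <= n)%N) :
  [/\ S13 R n \is a fin_num,
      S13 R n = ((4 ^+ n)^-1)%:E * mzeta_star R (nseq n 4%N),
      S13_star R n \is a fin_num
    & S13_star R n =
        \sum_(0 <= k < n.+1)
          ((4 ^+ k)^-1)%:E * mzeta_star R (nseq k 4%N)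
                           * mzeta R (nseq (n - k) 4%N) ].
Proof.
have [E [H [cE cH cS cY]]] := zigzag_gf_cvg R.
have eE k : mzeta R (nseq k 4%N) = (E k)%:E by exact: mzetaE (cE k).
have eH k : mzeta_star R (nseq k 4%N) = (H k)%:E by exact: mzeta_starE (cH k).
have eS := S13E hn (cS n); have eY := S13_starE hn (cY n).
split; rewrite ?eS ?eY //; first by rewrite eH -EFinM.
rewrite fpsM big_mkord -sumEFin; apply: eq_bigr => k _.
by rewrite eH eE -!EFinM.
Qed.
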